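(* For every binary string $S$, $VCdim(S)\leq 2\,\mathbf{alt}(S)$.
   Context: Binary strings (finite or right-infinite) are indexed from $0$. For a finite binary string $s$, let $n(s)=\{i: s_i=1\}\subseteq\mathbb{N}$ (indices relative to $s$). For a binary string $S$, let $\mathfrak{S}=\{n(s): s \text{ a finite contiguous substring of } S\}$. A set $B\subseteq\mathbb{N}$ is shattered if $\{c\cap B: c\in\mathfrak{S}\}$ is the power set of $B$; $VCdim(S)$ is the largest size of a shattered set ($\infty$ if none is largest). $\mathbf{alt}(S)$ denotes the number of maximal contiguous blocks of $1$'s appearing in $S$ (possibly infinite). *)

(* Defs.v *)
From mathcomp Require Import all_boot all_order all_algebra finmap.
From mathcomp Require Import boolp classical_sets cardinality constructive_ereal.

Set Implicit Arguments.
Unset Strict Implicit.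
Unset Printing Implicit Defensive.

Local Open Scope classical_set_scope.

Inductive binstring :=
  | FinString of seq bool
  | InfString of (nat -> bool).

Definition substring (s : seq bool) (S : binstring) : Prop :=
  match S with
  | FinString t => infix s t
  | InfString f => exists i : nat, s = mkseq (fun k => f (i + k)) (size s)
  end.

Definition nset (s : seq bool) : set nat := [set i | nth false s i].

Definition substring_class (S : binstring) : set (set nat) :=
  [set nset s | s in [set s | substring s S]].

Definition shattered (S : binstring) (B : set nat) : Prop :=
  [set c `&` B | c in substring_class S] = [set D | D `<=` B].

(* Sizes live in the extended integers, of which only the values n >= 0 and
   +oo occur. *)
Definition ecard (T : choiceType) (A : set T) : \bar int :=
  if `[< finite_set A >] then (Posz #|` fset_set A|)%:E else +oo%E.

Definition shattered_sizes (S : binstring) : set (\bar int) :=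
  [set ecard B | B in [set B | shattered S B]].

(* [xget] returns the largest size of a shattered set if there is one, and its
   default +oo otherwise. *)
Definition VCdim (S : binstring) : \bar int :=
  xget +oo%E [set d | shattered_sizes S d /\ ubound (shattered_sizes S) d].

Definition is_one (S : binstring) (i : nat) : Prop :=
  match S with
  | FinString t => nth false t i
  | InfString f => f i
  end.

(* A block is represented by its set of positions, which may be infinite. *)
Definition one_block (S : binstring) (I : set nat) : Prop :=
  [/\ I !=set0,
      forall i j k : nat, I i -> I k -> (i <= j <= k)%N -> I j &
      forall i : nat, I i -> is_one S i].

Definition max_one_block (S : binstring) (I : set nat) : Prop :=
  one_block S I /\ forall J, one_block S J -> I `<=` J -> J = I.

Definition alt (S : binstring) : \bar int :=
  ecard [set I | max_one_block S I].

(* Main.v *)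
Require Import Defs.
From mathcomp Require Import all_boot all_order all_algebra.
From mathcomp Require Import boolp classical_sets cardinality constructive_ereal.
From mathcomp Require Import finmap zify.

(** If [b_0 < b_1 < ... < b_2m] belong to a shattered set, some substring of [S]
    reads 1, 0, 1, ..., 0, 1 at these indices, so the [m + 1] ones lie in
    pairwise distinct maximal blocks of [S].  Hence a shattered set has at most
    [2 alt(S)] elements. *)

Set Implicit Arguments.
Unset Strict Implicit.
Unset Printing Implicit Defensive.

Local Open Scope classical_set_scope.

(** The bound [k < size s] matters: past its end [s] reads [false] by default, while [S] may still
    carry a one there. *)
Lemma substring_is_one (s : seq bool) (S : binstring) : substring s S ->
  exists i, forall k, (k < size s)%N -> is_one S (i + k) <-> nth false s k.
Proof.
case: S => [t /infixP [p [q ->]]|f [i si]] /=.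
  exists (size p) => k ks; rewrite nth_cat ltnNge leq_addr /=.
  by rewrite addKn nth_cat ks.
by exists i => k ks; rewrite si nth_mkseq.
Qed.

(** This is the maximal block through [p] if [S] has a one at [p], and is empty otherwise; [minn]
    and [maxn] treat both sides of [p] at once. *)
Definition block_at (S : binstring) (p : nat) : set nat :=
  [set q | forall r, (minn p q <= r <= maxn p q)%N -> is_one S r].

Lemma block_at_self (S : binstring) (p : nat) : is_one S p -> block_at S p p.
Proof. by move=> Sp r; rewrite minnn maxnn -eqn_leq => /eqP <-. Qed.

Lemma block_at_max (S : binstring) (p : nat) :
  is_one S p -> max_one_block S (block_at S p).
Proof.
move=> Sp; split; first split.
- by exists p; exact: block_at_self.
- move=> i j k pi pk ijk r rpj.
  (* The stretch from [p] to [j] is contained in the one from [p] to [k] or in the one from [p] to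
     [i]. *)
  case: (leqP p j) => pj; [apply: pk|apply: pi]; lia.
- by move=> i pi; apply: pi; lia.
move=> J [_ Jconv Jone] pJ; apply/seteqP; split=> // q Jq r rpq; apply: Jone.
have Jp : J p by apply: pJ; exact: block_at_self.
case: (leqP p q) => pq; [apply: (Jconv p r q)|apply: (Jconv q r p)] => //; lia.
Qed.

(** If the blocks agreed, [q] would lie in the block of [p], forcing a one at [z]. *)
Lemma block_at_neq (S : binstring) (p z q : nat) : (p <= z <= q)%N ->
  is_one S q -> ~ is_one S z -> block_at S p <> block_at S q.
Proof.
move=> pzq Sq Sz pq; apply: Sz.
by have := block_at_self Sq; rewrite -pq; apply; lia.
Qed.

Lemma alternation_le_blocks (S : binstring) (m : nat) (p : nat -> nat) :
  finite_set [set I | max_one_block S I] ->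
  (forall i j, (i < j <= m.*2)%N -> (p i < p j)%N) ->
  (forall j, (j <= m.*2)%N -> is_one S (p j) <-> ~~ odd j) ->
  (m < #|` fset_set [set I | max_one_block S I]|)%N.
Proof.
move=> finS pinc pone.
have one2 k : (k <= m)%N -> is_one S (p k.*2).
  by move=> km; apply/pone; rewrite ?odd_double// leq_double.
rewrite -[leqLHS](size_iota 0) -(size_map (fun k => block_at S (p k.*2))).
apply: uniq_leq_size.
  have neq k l : (k < l <= m)%N -> block_at S (p k.*2) <> block_at S (p l.*2).
    (* The zero at the odd index just after [k.*2] separates the two ones. *)
    move=> /andP[kl lm]; apply: (@block_at_neq _ _ (p k.*2.+1)).
    - by apply/andP; split; apply/ltnW/pinc; lia.
    - exact: one2.
    - by move/pone; rewrite /= odd_double => /(_ ltac:(lia)).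
  rewrite map_inj_in_uniq ?iota_uniq// => k l.
  rewrite !mem_iota !add0n => /andP[_ km] /andP[_ lm] e.
  have [kl|kl|//] := ltngtP k l; [case: (neq k l)|case: (neq l k)] => //; lia.
move=> I /mapP[k]; rewrite mem_iota => /andP[_ km] ->.
rewrite in_fset_set//; apply: mem_set; apply: block_at_max; apply: one2; lia.
Qed.

(** Bounding finite subsets of [B], rather than [B] itself, lets the same argument also yield that
    [B] is finite. *)
Lemma shattered_fset_le (S : binstring) (B : set nat) (F : {fset nat}) :
  shattered S B -> [set` F] `<=` B ->
  finite_set [set I | max_one_block S I] ->
  (#|` F| <= 2 * #|` fset_set [set I | max_one_block S I]|)%N.
Proof.
move=> shB FB finS; rewrite leqNgt; apply/negP.
set m := #|` _| => mF.
pose b := sort leq F.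
have bF x : (x \in b) = (x \in F) by rewrite mem_sort.
have mb : (m.*2 < size b)%N by rewrite size_sort -mul2n.
have binc i j : (i < j < size b)%N -> (nth 0%N b i < nth 0%N b j)%N.
  move=> /andP[ij jb]; apply: (sorted_ltn_nth ltn_trans) => //.
  - rewrite ltn_sorted_uniq_leq sort_uniq fset_uniq.
    by rewrite sort_sorted//; exact: leq_total.
  - by rewrite inE (ltn_trans ij).
have bB j : (j < size b)%N -> B (nth 0%N b j).
  by move=> jb; apply: FB; rewrite /= -bF mem_nth.
(* Cutting out this subset of [B] forces the alternating pattern on [s]. *)
pose D := [set x | exists2 j, (j <= m.*2)%N && ~~ odd j & x = nth 0%N b j].
have : [set D | D `<=` B] D.
  by move=> _ [j /andP[jm _] ->]; apply: bB; exact: leq_ltn_trans mb.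
rewrite -shB => -[_ [s Ss <-] sD].
have [i iS] := substring_is_one Ss.
have sP j : (j <= m.*2)%N -> nth false s (nth 0%N b j) <-> ~~ odd j.
  move=> jm; split=> [sj|jodd].
    have : D (nth 0%N b j).
      by rewrite -sD; split=> //; apply: bB; exact: leq_ltn_trans mb.
    case=> k /andP[km kodd] jk.
    have [jk'|kj|->//] := ltngtP j k.
    - by have := @binc j k; rewrite jk ltnn => /(_ ltac:(lia)).
    - by have := @binc k j; rewrite jk ltnn => /(_ ltac:(lia)).
  have : D (nth 0%N b j) by exists j; rewrite ?jm.
  by rewrite -sD => -[].
(* The zeros read at odd indices must be genuine letters of [s], not default values. This holds
   because the last index [m.*2] is even, so [s] has a one there and extends beyond all earlier
   positions. *)
have lts j : (j <= m.*2)%N -> (nth 0%N b j < size s)%N.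
  move=> jm; have last_s : (nth 0%N b m.*2 < size s)%N.
    rewrite ltnNge; apply/negP => /(nth_default false) snth.
    by have := sP m.*2 (leqnn _); rewrite snth odd_double => -[_ /(_ isT)].
  have [->//|jm'] := eqVneq j m.*2.
  by apply: ltn_trans last_s; apply: binc; lia.
have := @alternation_le_blocks S m (fun j => i + nth 0%N b j)%N finS.
rewrite -/m ltnn => h; suff : false by []; apply: h => [j k jk|j jm].
  by rewrite ltn_add2l binc//; lia.
by rewrite iS ?lts//; exact: sP.
Qed.

Lemma shattered_finite (S : binstring) (B : set nat) : shattered S B ->
  finite_set [set I | max_one_block S I] -> finite_set B.
Proof.
move=> shB finS; apply: contrapT => infB.
pose n := (2 * #|` fset_set [set I | max_one_block S I]|)%N.
have [F FB] := infinite_set_fset n.+1 infB.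
by rewrite ltnNge (shattered_fset_le shB FB finS).
Qed.

Lemma shattered_card_le (S : binstring) (B : set nat) : shattered S B ->
  finite_set [set I | max_one_block S I] ->
  (#|` fset_set B| <= 2 * #|` fset_set [set I | max_one_block S I]|)%N.
Proof.
move=> shB finS; apply: (shattered_fset_le shB) => //.
by rewrite fset_setK//; exact: shattered_finite finS.
Qed.

Lemma shattered0 (S : binstring) : shattered S set0.
Proof.
apply/seteqP; split=> [_ [c _ <-] x []//|D /=].
rewrite subset0 => ->.
exists (nset [::]); last by rewrite setI0.
exists [::] => //; case: S => [t|f] /=; first by rewrite infix0s.
by exists 0%N.
Qed.

(** The sizes of shattered sets are bounded, and [set0] provides one, so a largest exists and [xget]
    does not return its default [+oo]. *)
Lemma VCdim_attained (S : binstring) :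
  finite_set [set I | max_one_block S I] -> shattered_sizes S (VCdim S).
Proof.
move=> finS; rewrite /VCdim; case: xgetP => [d _ []//|nomax]; exfalso.
pose P n := `[< exists2 B, shattered S B & #|` fset_set B| = n >].
have exP : exists n, P n.
  exists #|` fset_set (@set0 nat)|; apply/asboolP; exists set0 => //.
  exact: shattered0.
have ubP n : P n -> (n <= 2 * #|` fset_set [set I | max_one_block S I]|)%N.
  by move=> /asboolP[B shB <-]; exact: shattered_card_le.
have ecardE B : shattered S B -> ecard B = (Posz #|` fset_set B|)%:E.
  by move=> shB; rewrite /ecard asboolT//; exact: shattered_finite finS.
have [n /asboolP[B shB Bn] nmax] := ex_maxnP exP ubP.
apply: (nomax (ecard B)); split; first by exists B.
move=> _ [C shC <-]; rewrite !ecardE// lee_fin lez_nat Bn.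
by apply: nmax; apply/asboolP; exists C.
Qed.

Theorem theorem5 (S : binstring) : (VCdim S <= 2%:E * alt S)%E.
Proof.
(* With infinitely many blocks the right-hand side is [+oo]. *)
rewrite /alt /ecard; case: asboolP => finS; last first.
  by rewrite gt0_muley ?leey// lte_fin.
have [B shB <-] := VCdim_attained finS.
rewrite /ecard asboolT; last exact: shattered_finite finS.
by rewrite -EFinM lee_fin -PoszM lez_nat; exact: shattered_card_le.
Qed.
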